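(* Let $\mathcal X,\mathcal Z$ be complex Hilbert spaces and let $(E,AQ)$ be a port-Hamiltonian differential-algebraic equation (pH-DAE), where $E,Q\in L(\mathcal X,\mathcal Z)$ and $A\colon\mathcal D(A)\subseteq\mathcal Z\to\mathcal Z$. (i) If there exists $\omega>0$ with $(\omega,\infty)\subseteq\rho(E,AQ)$, then the resolvent index of $(E,AQ)$ exists and is at most $2$. (ii) If there exists $\omega>0$ with $\mathbb C_{\mathrm{Re}>\omega}\subseteq\rho(E,AQ)$, then the complex resolvent index of $(E,AQ)$ exists and is at most $3$.
   Context: $L(\mathcal X,\mathcal Z)$ denotes bounded linear operators; $\mathbb N=\{0,1,2,\dots\}$; $\mathbb C_{\mathrm{Re}>\omega}=\{\lambda\in\mathbb C:\operatorname{Re}\lambda>\omega\}$. $(E,AQ)$ is a pH-DAE if: $E,Q\in L(\mathcal X,\mathcal Z)$; $A\colon\mathcal D(A)\subseteq\mathcal Z\to\mathcal Z$ is closed, densely defined and dissipative ($\operatorname{Re}\langle Az,z\rangle\le0$ for all $z\in\mathcal D(A)$); $\operatorname{ran}E$ is closed; $Q$ is (boundedly) invertible; and $E^*Q=Q^*E\ge0$, i.e. $\langle E^*Qx,x\rangle\ge0$ for all $x\in\mathcal X$. The domain of $AQ$ is $\{x\in\mathcal X:Qx\in\mathcal D(A)\}$. For a closed densely defined operator $B\colon\mathcal D(B)\subseteq\mathcal X\to\mathcal Z$, $\rho(E,B)=\{\lambda\in\mathbb C:(\lambda E-B)^{-1}\in L(\mathcal Z,\mathcal X)\}$. The resolvent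 index (respectively complex resolvent index) of $(E,B)$ is the smallest $p\in\mathbb N$ such that there exist $\omega\in\mathbb R$, $C>0$ with $(\omega,\infty)\subseteq\rho(E,B)$ (respectively $\mathbb C_{\mathrm{Re}>\omega}\subseteq\rho(E,B)$) and $\|(\lambda E-B)^{-1}\|\le C|\lambda|^{p-1}$ for all $\lambda\in(\omega,\infty)$ (respectively all $\lambda\in\mathbb C_{\mathrm{Re}>\omega}$); it exists if some such $p$ exists. *)

(* Defs.v *)
From HB Require Import structures.
From mathcomp Require Import all_boot all_order all_algebra.
From mathcomp Require Import complex sesquilinear.
From mathcomp Require Import all_classical all_reals all_analysis.

Set Implicit Arguments.
Unset Strict Implicit.
Unset Printing Implicit Defensive.

Import Order.TTheory GRing.Theory Num.Theory.
Import numFieldNormedType.Exports.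

Local Open Scope classical_set_scope.
Local Open Scope ring_scope.
Local Open Scope complex_scope.

(* [{dot H for conjC}] is linear in its first argument and conjugate-linear in
   its second one. *)
HB.mixin Record isHilbert (R : realType) (H : Type)
    of CompleteNormedModule R[i] H := {
  inner_form : {dot H for (@Num.conj R[i])} ;
  normr_inner_form : forall x : H, `|x| ^+ 2 = inner_form x x
}.

#[short(type="hilbertType")]
HB.structure Definition Hilbert (R : realType) :=
  {H of isHilbert R H & CompleteNormedModule R[i] H}.

Definition inner (R : realType) (H : hilbertType R) (x y : H) : R[i] :=
  @inner_form R H x y.

(* The norms of the library take their values in the scalar field [R[i]]. *)
Definition rnorm (R : realType) (V : normedZmodType R[i]) (v : V) : R :=
  complex.Re `|v|.

Section Operators.
Context {R : realType}.
Implicit Types X Z : hilbertType R.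

Definition bounded_op X Z (T : X -> Z) : Prop :=
  exists M : R, forall x, rnorm (T x) <= M * rnorm x.

(* Only meaningful for bounded [T]: [sup] of an unbounded set is [0]. *)
Definition opnorm X Z (T : X -> Z) : R :=
  sup [set rnorm (T x) | x in [set x : X | rnorm x <= 1]].

Definition boundedly_invertible X Z (Q : X -> Z) : Prop :=
  exists S : {linear Z -> X}, [/\ bounded_op S, cancel Q S & cancel S Q].

(* For bounded linear [T], the Riesz representation theorem says that the set
   is a singleton for each [z], so that the default value [0] is not used. *)
Definition adjoint X Z (T : X -> Z) (z : Z) : X :=
  xget 0 [set y | forall x : X, inner (T x) z = inner x y].

(* Partially defined linear operators; the values of [op_fun] outside
   [op_dom] are irrelevant. *)
Record operator X Z := Operator {
  op_dom : set X ;
  op_fun :> X -> Z ;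
  op_dom0 : op_dom 0 ;
  op_domP : forall (a : R[i]) x y,
    op_dom x -> op_dom y -> op_dom (a *: x + y) ;
  op_linear : forall (a : R[i]) x y,
    op_dom x -> op_dom y -> op_fun (a *: x + y) = a *: op_fun x + op_fun y
}.

Definition densely_defined X Z (B : operator X Z) : Prop := dense (op_dom B).

Definition closed_op X Z (B : operator X Z) : Prop :=
  closed [set p : X * Z | op_dom B p.1 /\ p.2 = B p.1].

Definition dissipative Z (A : operator Z Z) : Prop :=
  forall z, op_dom A z -> complex.Re (inner (A z) z) <= 0.

Program Definition op_comp X Z (A : operator Z Z) (Q : {linear X -> Z}) :
    operator X Z :=
  @Operator X Z [set x | op_dom A (Q x)] (A \o Q) _ _ _.
Next Obligation. by move=> X Z A Q /=; rewrite linear0; exact: op_dom0. Qed.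
Next Obligation.
by move=> X Z A Q a x y /= Ax Ay; rewrite linearP; exact: op_domP.
Qed.
Next Obligation.
by move=> X Z A Q a x y /= Ax Ay; rewrite linearP; exact: op_linear.
Qed.

Program Definition pencil X Z (E : {linear X -> Z}) (B : operator X Z)
    (l : R[i]) : operator X Z :=
  @Operator X Z (op_dom B) (fun x => l *: E x - B x) _ _ _.
Next Obligation. by move=> X Z E B l; exact: op_dom0. Qed.
Next Obligation. by move=> X Z E B l a x y; exact: op_domP. Qed.
Next Obligation.
move=> X Z E B l a x y /= Bx By; rewrite linearP op_linear // scalerDr scalerBr.
by rewrite !scalerA (mulrC l) opprD addrACA.
Qed.

Definition op_bijective X Z (B : operator X Z) : Prop :=
  set_bij (op_dom B) [set: Z] B.

(* The inverse of [B], for bijective [B] (see [op_bijective]). *)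
Definition op_inv X Z (B : operator X Z) (z : Z) : X :=
  xget 0 [set x | op_dom B x /\ B x = z].

(* The inverse of a bijective linear operator is linear, hence
   "[(l E - B)^-1] is in L(Z, X)" only adds boundedness to bijectivity. *)
Definition resolvent_set X Z (E : {linear X -> Z}) (B : operator X Z) :
    set R[i] :=
  [set l | op_bijective (pencil E B l) /\ bounded_op (op_inv (pencil E B l))].

Definition real_ray (w : R) : set R[i] := [set r%:C | r in `]w, +oo[].

Definition right_half_plane (w : R) : set R[i] := [set l | w < complex.Re l].

(* The exponent [p - 1] is taken in [int], so that it is [-1] for [p = 0]. *)
Definition resolvent_growth (S : R -> set R[i]) X Z (E : {linear X -> Z})
    (B : operator X Z) (p : nat) : Prop :=
  exists w C : R, [/\ 0 < C, S w `<=` resolvent_set E B &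
    forall l, S w l ->
      opnorm (op_inv (pencil E B l)) <= C * rnorm l ^ (p%:Z - 1)].

Definition is_smallest (P : nat -> Prop) (p : nat) : Prop :=
  P p /\ forall q, P q -> (p <= q)%N.

Definition resolvent_index X Z (E : {linear X -> Z}) (B : operator X Z) :
    nat -> Prop :=
  is_smallest (resolvent_growth real_ray E B).

Definition complex_resolvent_index X Z (E : {linear X -> Z})
    (B : operator X Z) : nat -> Prop :=
  is_smallest (resolvent_growth right_half_plane E B).

(* In [R[i]], [0 <= c] means that [c] is real and nonnegative. *)
Record pH_DAE X Z (E : {linear X -> Z}) (A : operator Z Z)
    (Q : {linear X -> Z}) : Prop := {
  pH_E_bounded : bounded_op E ;
  pH_Q_bounded : bounded_op Q ;
  pH_A_closed : closed_op A ;
  pH_A_dense : densely_defined A ;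
  pH_A_dissipative : dissipative A ;
  pH_E_range : closed (range E) ;
  pH_Q_inv : boundedly_invertible Q ;
  pH_EQ_sym : adjoint E \o Q = adjoint Q \o E ;
  pH_EQ_ge0 : forall x, 0 <= inner (adjoint E (Q x)) x
}.

End Operators.

(* Main.v *)
Require Import Defs.
From mathcomp Require Import all_boot all_order all_algebra.
From mathcomp Require Import complex sesquilinear.
From mathcomp Require Import all_classical all_reals all_analysis.
From mathcomp Require Import ring lra.

(* Put a(x, y) = <E x, Q y>.  By the pH condition a is a Hermitian form with
   a(x, x) >= 0, so |E x|^2 <= M a(x, x) for some M.  If (l E - A Q) x = y with
   Re l > 0, pairing with Q x and using that A is dissipative gives
   Re l * a(x, x) <= |y| |Q x|.  For a fixed l0 in the resolvent set,
   x = (l0 E - A Q)^-1 (y + (l0 - l) E x), hence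
   |x| <= C |y| + C |l - l0| |E x| with |E x|^2 <= M' |x| |y| / Re l,
   and AM-GM yields |x| <= D |l|^2 / Re l * |y|.  On the real ray the factor is
   |l|, on a half-plane Re l > w > 0 it is at most |l|^2 / w. *)

Set Implicit Arguments.
Unset Strict Implicit.
Unset Printing Implicit Defensive.

Import Order.TTheory GRing.Theory Num.Theory.
Import numFieldNormedType.Exports.

Local Open Scope classical_set_scope.
Local Open Scope ring_scope.
Local Open Scope complex_scope.

(** * Real part of the inner product: Cauchy-Schwarz, completeness, Riesz representation *)

Section RealPart.
Context {R : realType}.

Lemma rnormE (V : normedZmodType R[i]) (v : V) : (rnorm v)%:C = `|v|.
Proof. by apply: RRe_real; exact: normr_real. Qed.

Lemma rnorm_ge0 (V : normedZmodType R[i]) (v : V) : 0 <= rnorm v.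
Proof. by rewrite -ler0c rnormE. Qed.

Lemma rnormD (V : normedZmodType R[i]) (u v : V) :
  rnorm (u + v) <= rnorm u + rnorm v.
Proof. by rewrite -lecR rmorphD /= !rnormE ler_normD. Qed.

Lemma rnormZ (V : normedModType R[i]) (a : R[i]) (v : V) :
  rnorm (a *: v) = rnorm a * rnorm v.
Proof. by apply: complexI; rewrite rmorphM /= !rnormE normrZ. Qed.

Lemma Re_le_rnorm (a : R[i]) : complex.Re a <= rnorm a.
Proof.
rewrite -lecR rnormE; apply: le_trans (normc_ge_Re a).
by rewrite lecR ler_norm.
Qed.

Lemma Re_realM (t : R) (a : R[i]) : complex.Re (t%:C * a) = t * complex.Re a.
Proof. by case: a => a b /=; rewrite mul0r subr0. Qed.

Definition rinner (H : hilbertType R) (x y : H) : R := complex.Re (inner x y).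

Context {H : hilbertType R}.
Implicit Types x y z : H.

Lemma innerC x y : inner x y = (inner y x)^*.
Proof. by rewrite /inner hermC expr0 mul1r. Qed.

Lemma innerZl (a : R[i]) x y : inner (a *: x) y = a * inner x y.
Proof. by rewrite /inner linearZl_LR. Qed.

Lemma rinnerC x y : rinner x y = rinner y x.
Proof. by rewrite /rinner innerC; case: (inner y x). Qed.

Lemma rinnerDl x y z : rinner (x + y) z = rinner x z + rinner y z.
Proof. by rewrite /rinner /inner linearDl /= raddfD. Qed.

Lemma rinnerZl (t : R) x y : rinner (t%:C *: x) y = t * rinner x y.
Proof. by rewrite /rinner innerZl Re_realM. Qed.

Lemma rinnerDr x y z : rinner z (x + y) = rinner z x + rinner z y.
Proof. by rewrite !(rinnerC z) rinnerDl. Qed.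

Lemma rinnerZr (t : R) x y : rinner x (t%:C *: y) = t * rinner x y.
Proof. by rewrite !(rinnerC x) rinnerZl. Qed.

Lemma rinnerNl x y : rinner (- x) y = - rinner x y.
Proof. by rewrite -scaleN1r -(rmorphN1 (real_complex R)) rinnerZl mulN1r. Qed.

Lemma rinnerNr x y : rinner x (- y) = - rinner x y.
Proof. by rewrite !(rinnerC x) rinnerNl. Qed.

Lemma sqr_rnorm x : rnorm x ^+ 2 = rinner x x.
Proof. by rewrite /rinner /inner -normr_inner_form -rnormE -rmorphXn. Qed.

(** With [a = |x|] and [b = |y|], the square [|b x - a y|^2 >= 0] expands to [2 a b (a b - <x, y>)],
    and [a b] cancels once both vectors are nonzero. *)
Lemma rinner_le x y : rinner x y <= rnorm x * rnorm y.
Proof.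
set a := rnorm x; set b := rnorm y.
have [x0|xN0] := eqVneq x 0.
  by rewrite {1}x0 /rinner /inner linear0l mulr_ge0 // rnorm_ge0.
have [y0|yN0] := eqVneq y 0.
  by rewrite rinnerC {1}y0 /rinner /inner linear0l mulr_ge0 // rnorm_ge0.
have gt0 (z : H) : z != 0 -> 0 < rnorm z by rewrite -ltcR rnormE normr_gt0.
have ab_gt0 : 0 < a * b by rewrite mulr_gt0 ?gt0.
have : 0 <= rnorm (b%:C *: x - a%:C *: y) ^+ 2 by exact: sqr_ge0.
rewrite sqr_rnorm rinnerDl !rinnerDr !rinnerNl !rinnerNr !rinnerZl !rinnerZr.
rewrite -!sqr_rnorm (rinnerC y) -/a -/b => h.
rewrite -(ler_pM2l ab_gt0); lra.
Qed.

Lemma sqr_rnormB x y :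
  rnorm (x - y) ^+ 2 = rnorm x ^+ 2 - 2 * rinner x y + rnorm y ^+ 2.
Proof.
rewrite !sqr_rnorm rinnerDl !rinnerDr !rinnerNl !rinnerNr (rinnerC y); ring.
Qed.

Lemma sqr_rnormD x y :
  rnorm (x + y) ^+ 2 = rnorm x ^+ 2 + 2 * rinner x y + rnorm y ^+ 2.
Proof. rewrite !sqr_rnorm rinnerDl !rinnerDr (rinnerC y); ring. Qed.

Lemma sqr_rnorm_realZ (t : R) x :
  rnorm (t%:C *: x) ^+ 2 = t ^+ 2 * rnorm x ^+ 2.
Proof. by rewrite !sqr_rnorm rinnerZl rinnerZr mulrA. Qed.

(** Completeness restated with real tolerances: a positive element of [R[i]] is real, so both kinds
    of epsilon agree. *)
Lemma rnorm_cauchy_cvg (u : nat -> H) :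
  (forall e : R, 0 < e -> exists N, forall n m, (N <= n)%N -> (N <= m)%N ->
     rnorm (u n - u m) < e) ->
  exists l, forall e : R, 0 < e -> exists N, forall n, (N <= n)%N ->
     rnorm (u n - l) < e.
Proof.
have realc (e : R[i]) : 0 < e -> exists2 r : R, 0 < r & e = r%:C.
  move=> e0; exists (complex.Re e); last by rewrite RRe_real // gtr0_real.
  by move: e0; rewrite ltcE => /andP[].
move=> uC; have : cauchy (u @ \oo).
  apply/cauchy_exP => e /realc[r r0 ->]; have [N uN] := uC _ r0.
  exists (u N); exists N => // n /= Nn; rewrite -ball_normE /=.
  by rewrite -rnormE ltcR uN.
move=> /cauchy_cvg/cvg_ex[/= l ul]; exists l => e e0.
have : \forall n \near \oo, `|l - u n| < e%:C.
  by apply: cvgr_dist_lt; rewrite ?ltcR.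
by move=> [N _ lN]; exists N => n /lN /=; rewrite distrC -rnormE ltcR.
Qed.

(* The representing vector minimises [|x|^2 - 2 g x]; the parallelogram identity
   makes every minimising sequence Cauchy. *)
Lemma real_riesz (g : H -> R) (M : R) :
  (forall x y, g (x + y) = g x + g y) ->
  (forall t x, g (t%:C *: x) = t * g x) ->
  (forall x, g x <= M * rnorm x) ->
  exists y, forall x, g x = rinner x y.
Proof.
move=> gD gZ gM; pose J x := rnorm x ^+ 2 - 2 * g x.
have J_ge x : - M ^+ 2 <= J x.
  have := gM x; have := sqr_ge0 (M - rnorm x); rewrite /J; nra.
have J_par x y :
    rnorm (x - y) ^+ 2 = 2 * J x + 2 * J y - 4 * J ((2^-1)%:C *: (x + y)).
  rewrite /J sqr_rnorm_realZ sqr_rnormB sqr_rnormD gZ gD; lra.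
have infJ : has_inf (range J).
  split; first by exists (J 0), 0.
  by exists (- M ^+ 2); apply/lbP => _ [w _ <-].
pose d := inf (range J).
have d_le x : d <= J x by apply: ge_inf; [case: infJ|exists x].
have /choice[u ud] (n : nat) : exists x, J x < d + n.+1%:R^-1.
  have n0 : 0 < n.+1%:R^-1 :> R by [].
  have [_ [w _ <-] Jw] := inf_adherent n0 infJ.
  by exists w.
have small (e : R) : 0 < e -> exists N, forall n, (N <= n)%N -> n.+1%:R^-1 < e.
  move=> e0; have [N eN] : exists N : nat, e^-1 < N.+1%:R.
    by exists (Num.truncn e^-1); rewrite truncnS_gt.
  exists N => n Nn; rewrite invf_plt ?posrE //.
  by apply: lt_le_trans eN _; rewrite ler_nat.
have [|l ul] := @rnorm_cauchy_cvg u.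
  (* As [J] at the midpoint is at least [d], [J_par] bounds the squared distance by [2 (rn + rm)],
     which is below [e ^+ 2] for errors under [e ^+ 2 / 4]. *)
  move=> e e0; have [|N sN] := small (e ^+ 2 / 4); first by nra.
  exists N => n m /sN sn /sN sm.
  rewrite -(@ltr_pXn2r _ 2) ?nnegrE ?rnorm_ge0 ?(ltW e0) // J_par.
  move: (n.+1%:R^-1) (m.+1%:R^-1) (ud n) (ud m) sn sm => rn rm.
  have := d_le ((2^-1)%:C *: (u n + u m)).
  move: (J _) (J _) (J _) (e ^+ 2) => a b c e2; lra.
exists l => v; pose c := rinner v l - g v.
(* This is [J (l + t v) - J l >= 0], obtained along [u n] instead of through continuity of [J]. If
   the value [q] were negative, the errors [1/(n+1)] and [2 |u n - l| |t v|] would total less than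
   [K * (- q / K) = - q], contradicting [d <= J (u n + t v)]. *)
have main (t : R) : 0 <= t ^+ 2 * rnorm v ^+ 2 + 2 * t * c.
  set q := (X in 0 <= X); rewrite leNgt; apply/negP => q0.
  pose K := 1 + 2 * rnorm (t%:C *: v).
  have K0 : 0 < K by rewrite /K ltr_wpDr // mulr_ge0 // rnorm_ge0.
  have e0 : 0 < - q / K by rewrite divr_gt0 // oppr_gt0.
  have [N1 sN] := small _ e0; have [N2 lN] := ul _ e0.
  pose n := maxn N1 N2.
  have /sN s1 : (N1 <= n)%N by rewrite leq_maxl.
  have /lN l1 : (N2 <= n)%N by rewrite leq_maxr.
  have := d_le (u n + t%:C *: v).
  have := rinner_le (u n - l) (t%:C *: v).
  rewrite /J sqr_rnormD sqr_rnorm_realZ gD gZ !rinnerZr rinnerDl rinnerNl.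
  have := ler_wpM2r (rnorm_ge0 (t%:C *: v)) (ltW l1).
  have := ud n; rewrite /J; move: s1.
  have : K * (- q / K) = - q by rewrite mulrC divfK // gt_eqF.
  move: (- q / K) (n.+1%:R^-1) => e r; rewrite /q /K /c (rinnerC v).
  move: (rnorm (u n - l)) (rnorm (t%:C *: v)) (rinner (u n) v) => a k w.
  move: (rnorm (u n) ^+ 2) (rnorm v ^+ 2) => P V; rewrite (rinnerC l); lra.
(* For this [t] the quadratic equals [- t^2 (|v|^2 + 2)], which forces [t = 0]; the [+ 1] keeps [s]
   positive when [v = 0]. *)
pose s := rnorm v ^+ 2 + 1; pose t := - c / s.
have s0 : 0 < s by rewrite /s ltr_wpDl // sqr_ge0.
have cE : c = - (t * s) by rewrite /t divfK ?opprK // gt_eqF.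
have t0 : t = 0.
  apply/eqP; rewrite -sqrf_eq0 eq_le sqr_ge0 andbT.
  have := main t; rewrite cE /s.
  have := sqr_ge0 t; have := sqr_ge0 (t * rnorm v); nra.
by apply/esym/eqP; rewrite -subr_eq0 -/c cE t0 mul0r oppr0.
Qed.

End RealPart.

(** * The adjoint of a bounded operator *)

Section Adjoint.
Context {R : realType} {X Z : hilbertType R}.

Lemma bounded_op_gt0 (T : X -> Z) : bounded_op T ->
  exists2 M : R, 0 < M & forall x, rnorm (T x) <= M * rnorm x.
Proof.
move=> [M TM]; exists (`|M| + 1) => [|x]; first by rewrite ltr_wpDl.
apply: le_trans (TM x) _; apply: ler_wpM2r; first exact: rnorm_ge0.
by rewrite (le_trans (ler_norm M)) // lerDl.
Qed.

(** [real_riesz] represents the real part of [u |-> <T u, z>], and replacing [u] by ['i *: u]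
    recovers the imaginary part. Hence the set from which [adjoint] chooses is inhabited. *)
Lemma inner_adjoint (T : {linear X -> Z}) (z : Z) (x : X) :
  bounded_op T -> inner (T x) z = inner x (adjoint T z).
Proof.
move=> /bounded_op_gt0[M M0 TM].
suff ex : exists y, forall x, inner (T x) z = inner x y.
  by rewrite /adjoint; exact: (xgetPex 0 ex).
have [|t u|u|y Ty] := @real_riesz R X (fun u => rinner (T u) z) (M * rnorm z).
- by move=> u v; rewrite linearD rinnerDl.
- by rewrite linearZ rinnerZl.
- apply: le_trans (rinner_le _ _) _; rewrite mulrAC.
  by apply: ler_wpM2r (TM u); exact: rnorm_ge0.
exists y => u; apply/eqP; rewrite eq_complex; apply/andP; split; apply/eqP.
  exact: Ty.
have := Ty ('i *: u); rewrite /rinner linearZ !innerZl !(mulrC 'i) !ReiNIm.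
exact: oppr_inj.
Qed.

End Adjoint.

(** * Inverses of pencils, the energy form and the resolvent estimate *)

Section Pencil.
Context {R : realType} {X Z : hilbertType R}.
Implicit Types (E Q : {linear X -> Z}) (A : operator Z Z) (B : operator X Z).

(** Surjectivity makes the set under [xget] inhabited, so [op_inv] picks a genuine preimage. *)
Lemma op_invP B (z : Z) :
  op_bijective B -> op_dom B (op_inv B z) /\ B (op_inv B z) = z.
Proof.
move=> [_ _ /(_ z I)[x Bx Bxz]].
have ex : exists x, op_dom B x /\ B x = z by exists x.
exact: (xgetPex 0 ex).
Qed.

Lemma op_invK B x : op_bijective B -> op_dom B x -> op_inv B (B x) = x.
Proof.
move=> Bbij Bx; have [Bi BiE] := op_invP (B x) Bbij.
by case: Bbij => _ Binj _; apply: Binj; rewrite ?inE.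
Qed.

Lemma opnorm_le (T : Z -> X) (K : R) : 0 <= K ->
  (forall z, rnorm (T z) <= K * rnorm z) -> opnorm T <= K.
Proof.
move=> K0 TK; apply: ge_sup.
  by exists (rnorm (T 0)), 0 => //=; rewrite /rnorm normr0.
move=> _ [z /= z1 <-]; apply: le_trans (TK z) _.
by rewrite -[leRHS]mulr1 ler_wpM2l.
Qed.

(** The order of [R[i]] also makes the form real, which later lets [Re l] be factored out of the
    pairing. *)
Lemma inner_pH_ge0 E A Q x : pH_DAE E A Q -> 0 <= inner (E x) (Q x).
Proof.
move=> pH; have := pH_EQ_ge0 pH x.
by rewrite (inner_adjoint _ _ (pH_E_bounded pH)) innerC conj_ge0.
Qed.

(** A Cauchy-Schwarz argument for the form [<E x, Q y>]: at [y = Q^-1 E x] its value is [|E x|^2],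
    while its value at [(y, y)] is at most [M K |E x|^2], with [M] bounding [E] and [K] bounding
    [Q^-1]. *)
Lemma rnorm_pH_le E A Q : pH_DAE E A Q ->
  exists2 M : R, 0 < M &
    forall x, rnorm (E x) ^+ 2 <= M * rinner (E x) (Q x).
Proof.
move=> pH; have [S [/bounded_op_gt0[K K0 SK] _ QS]] := pH_Q_inv pH.
have [M M0 EM] := bounded_op_gt0 (pH_E_bounded pH).
have MK0 : 0 < M * K by rewrite mulr_gt0.
have sym x y : rinner (E y) (Q x) = rinner (E x) (Q y).
  rewrite [RHS]rinnerC /rinner (inner_adjoint _ _ (pH_E_bounded pH)).
  rewrite (inner_adjoint _ _ (pH_Q_bounded pH)).
  by have /(congr1 (fun f => f x)) /= -> := pH_EQ_sym pH.
have ge0 x : 0 <= rinner (E x) (Q x).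
  by have := inner_pH_ge0 x pH; rewrite lecE => /andP[].
(* Positivity of the form at [M K x - y], where [y = Q^-1 E x]. *)
exists (M * K) => // x; set y := S (E x).
have Qy : Q y = E x by rewrite /y QS.
have Ey : rinner (E y) (Q y) <= M * K * rnorm (E x) ^+ 2.
  rewrite Qy; apply: le_trans (rinner_le _ _) _.
  rewrite expr2 mulrA; apply: ler_wpM2r; first exact: rnorm_ge0.
  by apply: le_trans (EM _) _; rewrite -mulrA ler_pM2l // SK.
have := ge0 ((M * K)%:C *: x - y).
rewrite !linearB !linearZ /= rinnerDl !rinnerDr !rinnerNl !rinnerNr.
rewrite !rinnerZl !rinnerZr (sym x y).
have -> : rinner (E x) (Q y) = rnorm (E x) ^+ 2 by rewrite Qy sqr_rnorm.
move: Ey; set a := rinner _ _; set b := rinner _ _; set n := rnorm _ ^+ 2.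
by move=> h1 h2; rewrite -(ler_pM2l MK0); lra.
Qed.

(** [D] does not depend on [l], and the factor [|l|^2 / Re l] is left unsimplified so that it serves
    both the ray and the half-plane. *)
Lemma pH_resolvent_estimate E A Q (w : R) :
  pH_DAE E A Q -> 0 < w -> resolvent_set E (op_comp A Q) (w + 1)%:C ->
  exists2 D : R, 0 < D & forall l,
    w < complex.Re l -> resolvent_set E (op_comp A Q) l ->
    opnorm (op_inv (pencil E (op_comp A Q) l)) <=
      D * (rnorm l ^+ 2 / complex.Re l).
Proof.
move=> pH w0 [bij0 /bounded_op_gt0[C C0 invC]].
have [M M0 EM] := rnorm_pH_le pH.
have [K K0 QK] := bounded_op_gt0 (pH_Q_bounded pH).
(* Chosen so that [|w + 1 - l| <= k |l|], using [w < Re l <= |l|]. *)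
pose k := 1 + (w + 1) / w.
have k0 : 0 < k by rewrite /k addr_gt0 // divr_gt0 // addr_gt0.
(* The first summand absorbs [2 C |y|] through [w <= |l|^2 / Re l]; the second is the coefficient in
   [G] below. *)
exists (2 * C / w + (C * k) ^+ 2 * (M * K)).
  by rewrite addr_gt0 // ?divr_gt0 ?mulr_gt0 ?exprn_gt0 ?mulr_gt0.
move=> l wl [bij _]; set D := (X in X * _).
have rl : complex.Re l <= rnorm l by exact: Re_le_rnorm.
have l0 : 0 < complex.Re l by exact: lt_trans wl.
have D0 : 0 <= D * (rnorm l ^+ 2 / complex.Re l).
  rewrite /D; apply: mulr_ge0.
    by rewrite addr_ge0 // ?divr_ge0 ?mulr_ge0 ?sqr_ge0 ?ltW.
  by rewrite divr_ge0 ?sqr_ge0 ?ltW.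
apply: opnorm_le => // y; set x := op_inv _ y.
have [Bx xE] := op_invP y bij; rewrite -/x in Bx xE.
have energy : complex.Re l * rinner (E x) (Q x) <= rnorm y * (K * rnorm x).
  apply: (@le_trans _ _ (rinner y (Q x))).
    rewrite -{1}xE /= rinnerDl rinnerNl /(rinner (_ *: _)) innerZl.
    have := RRe_real (ger0_real (inner_pH_ge0 x pH)); rewrite -/(rinner _ _).
    move=> <-; rewrite [l * _]mulrC Re_realM mulrC.
    by rewrite lerDl oppr_ge0; exact: (pH_A_dissipative pH).
  apply: le_trans (rinner_le _ _) _; apply: ler_wpM2l (QK x); exact: rnorm_ge0.
pose h := rnorm ((w + 1)%:C - l).
have xle : rnorm x <= C * (rnorm y + h * rnorm (E x)).
  rewrite -{1}(op_invK bij0 Bx); apply: le_trans (invC _) _.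
  rewrite ler_pM2l // -rnormZ.
  have -> : pencil E (op_comp A Q) (w + 1)%:C x = y + ((w + 1)%:C - l) *: E x.
    by rewrite -xE /= scalerBl [RHS]addrC addrA subrK.
  exact: rnormD.
have hle : h <= k * rnorm l.
  apply: le_trans (rnormD _ _) _.
  have -> : rnorm (- l) = rnorm l by rewrite /rnorm normrN.
  have -> : rnorm (w + 1)%:C = w + 1.
    by apply: complexI; rewrite rnormE ger0_norm // ler0c addr_ge0 // ltW.
  rewrite /k mulrDl mul1r addrC lerD2l mulrAC -mulrA ler_peMr //.
    by rewrite addr_ge0 // ltW.
  by rewrite ler_pdivlMr // mul1r (le_trans (ltW wl)).
set e := rnorm (E x) in xle *; set n := rnorm x in xle energy *.
set Y := rnorm y in xle energy *; set a := rinner _ _ in energy.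
pose q := rnorm l ^+ 2 / complex.Re l; rewrite -/q.
have qE : complex.Re l * q = rnorm l ^+ 2 by rewrite /q mulrC divfK // gt_eqF.
have wq : w <= q.
  rewrite /q ler_pdivlMr // expr2 ler_pM ?(ltW w0) ?(ltW l0) //.
  by rewrite (le_trans (ltW wl)).
clearbody q.
have [e0 n0 Y0 h0] : [/\ 0 <= e, 0 <= n, 0 <= Y & 0 <= h].
  by split; exact: rnorm_ge0.
pose G := (C * k) ^+ 2 * (M * K) * (q * Y).
have q0 : 0 < q by exact: lt_le_trans wq.
have G0 : 0 <= G.
  by rewrite /G !mulr_ge0 ?(ltW C0, ltW k0, ltW M0, ltW K0, ltW q0).
have le : complex.Re l * e ^+ 2 <= M * K * Y * n.
  apply: (@le_trans _ _ (M * (complex.Re l * a))).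
    by rewrite [leRHS]mulrCA ler_pM2l //; exact: EM.
  by rewrite -!mulrA ler_pM2l // mulrCA.
(* Replace [h] by [k |l|], write [|l|^2] as [Re l * q], and apply the energy bound [le] to
   [Re l * e ^+ 2]. *)
have BG : (C * (h * e)) ^+ 2 <= G * n.
  apply: (@le_trans _ _ ((C * k) ^+ 2 * q * (complex.Re l * e ^+ 2))).
    have -> : (C * k) ^+ 2 * q * (complex.Re l * e ^+ 2) =
        (C * (k * rnorm l * e)) ^+ 2.
      by rewrite !exprMn -qE; ring.
    have Che : C * (h * e) <= C * (k * rnorm l * e).
      by rewrite ler_pM2l // ler_wpM2r.
    by rewrite ler_pXn2r ?nnegrE // ?(le_trans _ Che) // !mulr_ge0 // ltW.
  have -> : G * n = (C * k) ^+ 2 * q * (M * K * Y * n) by rewrite /G; ring.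
  by apply: ler_wpM2l le; rewrite mulr_ge0 ?sqr_ge0 // ltW.
(* AM-GM on [G n]; the resulting [n / 2] is then absorbed into the left side of [xle], giving
   [n <= 2 C Y + G]. *)
have B_le : C * (h * e) <= (G + n) / 2.
  have s0 : 0 <= (G + n) / 2 by rewrite divr_ge0 ?addr_ge0.
  have c0 : 0 <= C * (h * e) by rewrite !mulr_ge0 // ltW.
  rewrite -(@ler_pXn2r _ 2) ?nnegrE //.
  apply: le_trans BG _; have := sqr_ge0 (G - n); lra.
have CY : 2 * C * Y <= 2 * C / w * (q * Y).
  by rewrite mulrA ler_wpM2r // mulrAC ler_pdivlMr // ler_pM2l // mulr_gt0.
apply: (@le_trans _ _ (2 * C * Y + G)); first by lra.
have -> : D * q * Y = 2 * C / w * (q * Y) + G by rewrite /D /G; ring.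
by rewrite lerD2r.
Qed.

(** Well-ordering of [nat], with [P] made boolean by classical logic. *)
Lemma is_smallest_exists (P : nat -> Prop) n :
  P n -> exists p, is_smallest P p /\ (p <= n)%N.
Proof.
move=> Pn; have ex : exists p, `[< P p >] by exists n; apply/asboolP.
exists (ex_minn ex); case: ex_minnP => p /asboolP Pp minp.
by split; [split=> // q Pq|]; apply: minp; apply/asboolP.
Qed.

End Pencil.

(** * Growth rates on the real ray and on the half-plane *)

Theorem proposition5p1 (R : realType) (X Z : hilbertType R)
    (E Q : {linear X -> Z}) (A : operator Z Z) (hpH : pH_DAE E A Q) :
  ((exists w : R, 0 < w /\ real_ray w `<=` resolvent_set E (op_comp A Q)) ->
    exists p : nat, resolvent_index E (op_comp A Q) p /\ (p <= 2)%N) /\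
  ((exists w : R,
      0 < w /\ right_half_plane w `<=` resolvent_set E (op_comp A Q)) ->
    exists p : nat, complex_resolvent_index E (op_comp A Q) p /\ (p <= 3)%N).
Proof.
split=> -[w [w0 wE]]; apply: is_smallest_exists.
- have [|D D0 est] := pH_resolvent_estimate hpH w0.
    by apply: wE; exists (w + 1) => //=; rewrite in_itv /= ltrDl ltr01.
  exists w, D; split=> // l wl; have lE := wE _ wl.
  case: wl => r /=; rewrite in_itv /= andbT => wr lr.
  have r0 : 0 < r := lt_trans w0 wr.
  rewrite -{}lr in lE *; apply: le_trans (est _ _ lE) _ => //=.
  (* On the ray [|l| = Re l = r], so [|l|^2 / Re l] is [r], the power [p - 1 = 1]. *)
  have -> : rnorm r%:C = r.
    by apply: complexI; rewrite rnormE ger0_norm // ler0c ltW.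
  by rewrite expr1z expr2 mulfK // gt_eqF.
- have [|D D0 est] := pH_resolvent_estimate hpH w0.
    by apply: wE; rewrite /right_half_plane /= ltrDl ltr01.
  (* The extra [1 / w] bounds [1 / Re l] on the half-plane, leaving [|l|^2], the power
     [p - 1 = 2]. *)
  exists w, (D / w); split=> [|//|l wl]; first by rewrite divr_gt0.
  apply: le_trans (est _ wl (wE _ wl)) _.
  have -> : rnorm l ^ (3%:Z - 1) = rnorm l ^+ 2 by [].
  rewrite -mulrA ler_pM2l // mulrC ler_wpM2r ?sqr_ge0 //.
  by rewrite lef_pV2 ?posrE ?(lt_trans w0 wl) // ltW.
Qed.
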